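(* Let $s$ be a nonnegative integer. Any $P_4$-sparse minimal $(s,1)$-polar obstruction is a cograph.
   Context: All graphs are simple and finite. A cograph is a graph with no induced path on four vertices. A graph is $P_4$-sparse if every set of five vertices induces at most one $P_4$ (induced path on four vertices). For nonnegative integers $s,k$, a graph $G$ is $(s,k)$-polar if its vertex set has a partition $(A,B)$ (parts may be empty) such that $G[A]$ is a complete multipartite graph with at most $s$ parts and $G[B]$ is a disjoint union of at most $k$ complete graphs. A minimal $(s,k)$-polar obstruction is a graph that is not $(s,k)$-polar but all of whose proper induced subgraphs are $(s,k)$-polar. *)

(* Defs.v *)
From mathcomp Require Import all_boot.
Set Implicit Arguments.
Unset Strict Implicit.
Unset Printing Implicit Defensive.

Record sgraph := SGraph {
  vertex :> finType;
  adj : rel vertex;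
  adj_sym : symmetric adj;
  adj_irr : irreflexive adj
}.

Section Induced.
Variables (G : sgraph) (S : {set G}).

Definition induced_adj : rel {x : G | x \in S} :=
  fun x y => adj (val x) (val y).

Fact induced_adj_sym : symmetric induced_adj.
Proof. by move=> x y; apply: adj_sym. Qed.

Fact induced_adj_irr : irreflexive induced_adj.
Proof. by move=> x; apply: adj_irr. Qed.

Definition induced : sgraph := SGraph induced_adj_sym induced_adj_irr.
End Induced.

Definition path_adj (n : nat) : rel 'I_n :=
  fun i j => (i.+1 == j :> nat) || (j.+1 == i :> nat).

Fact path_adj_sym n : symmetric (@path_adj n).
Proof. by move=> i j; rewrite /path_adj orbC. Qed.

Fact path_adj_irr n : irreflexive (@path_adj n).
Proof. by move=> i; rewrite /path_adj orbb eqn_leq ltnn. Qed.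

(* The path with n vertices (and n.-1 edges). *)
Definition path_graph (n : nat) : sgraph :=
  SGraph (@path_adj_sym n) (@path_adj_irr n).

Definition isomorphic (G H : sgraph) : Prop :=
  exists2 f : G -> H, bijective f & {mono f : x y / adj x y}.

Definition induces_P4 (G : sgraph) (W : {set G}) : Prop :=
  isomorphic (induced W) (path_graph 4).

Definition cograph (G : sgraph) : Prop :=
  forall W : {set G}, ~ induces_P4 W.

Definition P4_sparse (G : sgraph) : Prop :=
  forall S : {set G}, #|S| = 5 ->
  forall W1 W2 : {set G}, W1 \subset S -> W2 \subset S ->
  induces_P4 W1 -> induces_P4 W2 -> W1 = W2.

(* Blocks of [partition] are nonempty, so the bound on #|P| counts nonempty
   parts; the graph without vertices has 0 parts. *)
Definition complete_multipartite (s : nat) (G : sgraph) : Prop :=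
  exists P : {set {set G}},
    [/\ partition P [set: G], #|P| <= s &
        forall x y : G, adj x y = (pblock P x != pblock P y)].

Definition union_of_cliques (k : nat) (G : sgraph) : Prop :=
  exists P : {set {set G}},
    [/\ partition P [set: G], #|P| <= k &
        forall x y : G, adj x y = (x != y) && (pblock P x == pblock P y)].

Definition polar (s k : nat) (G : sgraph) : Prop :=
  exists A B : {set G},
    [/\ A :|: B = [set: G], [disjoint A & B],
        complete_multipartite s (induced A) &
        union_of_cliques k (induced B)].

Definition minimal_polar_obstruction (s k : nat) (G : sgraph) : Prop :=
  ~ polar s k G /\
  forall S : {set G}, S \proper [set: G] -> polar s k (induced S).

(* Main.v *)
(** In a P4-sparse graph, a vertex outside an induced path a-b-c-d is adjacent
    to none, to all, or to exactly the inner vertices b, c of the path.  Given a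
    polar partition (A, B) of G - b with B a clique, A contains a or d, and B
    meets the co-P3 {a, c, d}.  The first fact lets a and d be placed together
    in one part of A; the second shows that B has no vertex missing b and c, so
    b and c can be placed in B.  Hence G itself is polar. *)
Require Import Defs.
From mathcomp Require Import all_boot.

(** A colouring can be edited vertex by vertex, which is awkward with blocks. A vertex is coloured
    by the index of its block in an enumeration of [P]; conversely the nonempty fibres of [f] are
    the parts. *)
Lemma complete_multipartiteP (s : nat) (H : sgraph) :
  complete_multipartite s H <->
  exists2 f : H -> nat, forall x, f x < s & forall x y, adj x y = (f x != f y).
Proof.
split=> [[P [partP leP adjP]] | [f ltf adjf]].
  have inP x : pblock P x \in P.
    by apply: pblock_mem; rewrite (cover_partition partP) inE.
  exists (fun x => index (pblock P x) (enum P)) => [x | x y].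
    by apply: leq_trans leP; rewrite cardE index_mem mem_enum.
  rewrite adjP; congr negb; apply/eqP/eqP=> [-> // | eq_xy].
  have nthP z : nth set0 (enum P) (index (pblock P z) (enum P)) = pblock P z.
    by rewrite nth_index ?mem_enum.
  by rewrite -(nthP x) -(nthP y) eq_xy.
have eqv : {in [set: H] & &, equivalence_rel [rel x y | f x == f y]}.
  by split=> //= /eqP->.
exists (preim_partition f [set: H]); split; first exact: preim_partitionP.
  have sub : preim_partition f [set: H] \subset
             [set [set y | val i == f y] | i : 'I_s].
    apply/subsetP=> _ /imsetP[x _ ->]; apply/imsetP.
    by exists (Ordinal (ltf x)) => //; apply/setP=> y; rewrite !inE.
  apply: leq_trans (subset_leq_card sub) _.
  by apply: leq_trans (leq_imset_card _ _) _; rewrite card_ord.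
move=> x y; have /and3P[/eqP cov triv _] := preim_partitionP f [set: H].
rewrite eq_pblock ?cov ?inE // adjf.
by rewrite (pblock_equivalence_partition eqv) ?inE.
Qed.

Lemma union_of_cliques1P (H : sgraph) :
  union_of_cliques 1 H <-> forall x y : H, adj x y = (x != y).
Proof.
split=> [[P [partP leP adjP]] x y | adjH].
  have inP z : pblock P z \in P.
    by apply: pblock_mem; rewrite (cover_partition partP) inE.
  by rewrite adjP ((card_le1_eqP leP) _ _ (inP x) (inP y)) eqxx andbT.
have eqv : {in [set: H] & &, equivalence_rel [rel x y : H | true]} by [].
(* The total relation gives one block, or none when the graph is empty, as blocks must be
   nonempty. *)
pose P := equivalence_partition [rel x y : H | true] [set: H].
have /and3P[/eqP cov triv _] := equivalence_partitionP eqv.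
exists P; split; first exact: equivalence_partitionP.
  apply/card_le1_eqP=> _ _ /imsetP[x _ ->] /imsetP[y _ ->].
  by apply/setP=> z; rewrite !inE.
move=> x y; rewrite eq_pblock ?cov ?inE // adjH.
by rewrite (pblock_equivalence_partition eqv) ?inE ?andbT.
Qed.

Lemma polar_coloring (s : nat) (H : sgraph) :
  polar s 1 H <->
  exists (A : {set H}) (f : H -> nat),
    [/\ {in A, forall x, f x < s},
        {in A &, forall x y, adj x y = (f x != f y)} &
        {in ~: A &, forall x y, adj x y = (x != y)}].
Proof.
split=> [[A [B [covAB disAB /complete_multipartiteP[f ltf adjf]]]] | [A [f]]].
  move=> /union_of_cliques1P adjB.
  (* The default 0 is harmless: colours matter only on [A]. *)
  exists A, (fun x => if insub x is Some u then f u else 0).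
  split=> [x Ax | x y Ax Ay | x y].
  - by rewrite (insubT (fun x => x \in A) Ax).
  - by rewrite !(insubT (fun x => x \in A)) -adjf.
  have inB z : z \in ~: A -> z \in B.
    by rewrite inE => /negPf nAz; have := in_setT z; rewrite -covAB inE nAz.
  by move=> /inB Bx /inB By; have := adjB (Sub x Bx) (Sub y By).
move=> [ltf adjf adjB]; exists A, (~: A); split.
- exact: setUCr.
- by rewrite -setI_eq0 setICr.
- apply/complete_multipartiteP.
  exists (fun x => f (val x)) => [x | x y]; first exact/ltf/valP.
  by rewrite -adjf //; apply: valP.
- by apply/union_of_cliques1P=> x y; apply: adjB; apply: valP.
Qed.

(** Keeps the vertices in [G] instead of a subtype, so that a deleted vertex can be put back into
    the partition. *)
Lemma polar_induced_coloring (s : nat) (G : sgraph) (S : {set G}) :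
  polar s 1 (induced S) ->
  exists (A : {set G}) (f : G -> nat),
    [/\ A \subset S, {in A, forall x, f x < s},
        {in A &, forall x y, adj x y = (f x != f y)} &
        {in S :\: A &, forall x y, adj x y = (x != y)}].
Proof.
move=> /polar_coloring[A [f [ltf adjf adjB]]].
exists [set val x | x in A], (fun x => if insub x is Some u then f u else 0).
split=> [|_ /imsetP[x Ax ->]|_ _ /imsetP[x Ax ->] /imsetP[y Ay ->]|x y].
- by apply/subsetP=> _ /imsetP[x _ ->]; apply: valP.
- by rewrite valK; apply: ltf.
- by rewrite !valK -adjf.
move=> /setDP[Sx nAx] /setDP[Sy nAy].
have notA z (Sz : z \in S) :
    z \notin [set val x | x in A] -> (Sub z Sz : induced S) \in ~: A.
  by rewrite inE; apply: contra => Az; apply/imsetP; exists (Sub z Sz).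
exact: (adjB _ _ (notA x Sx nAx) (notA y Sy nAy)).
Qed.

Definition is_P4 {G : sgraph} (a b c d : G) : bool :=
  [&& uniq [:: a; b; c; d], adj a b, adj b c, adj c d,
      ~~ adj a c, ~~ adj a d & ~~ adj b d].

(** The isomorphism is the inverse of the map [g] listing the path, which is bijective because it is
    injective between types of cardinality four. *)
Lemma is_P4_induces (G : sgraph) (a b c d : G) :
  is_P4 a b c d -> induces_P4 [set x in [:: a; b; c; d]].
Proof.
move=> /and5P[Uabcd ab bc cd /and3P[/negPf ac /negPf ad /negPf bd]].
pose t (i : 'I_4) := nth a [:: a; b; c; d] i.
have t_in i : t i \in [set x in [:: a; b; c; d]] by rewrite inE mem_nth.
pose g i : induced [set x in [:: a; b; c; d]] := Sub (t i) (t_in i).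
have g_inj : injective g.
  move=> i j /(congr1 val)/eqP /=.
  by rewrite /t nth_uniq // => /eqP/val_inj.
have adj_g i j : adj (g i) (g j) = path_adj i j.
  rewrite /= /induced_adj /= /t /path_adj.
  case: i j => [[|[|[|[|//]]]] ?] [[|[|[|[|//]]]] ?] /=;
  by rewrite ?adj_irr ?ab ?bc ?cd ?ac ?ad ?bd // adj_sym ?ab ?bc ?cd ?ac ?ad ?bd.
have [h gK hK] : bijective g.
  apply: inj_card_bij => //.
  by rewrite card_sig card_ord cardsE (card_uniqP Uabcd).
exists h; first by exists g.
by move=> x y; rewrite -{2}(hK x) -{2}(hK y) adj_g.
Qed.

Lemma induces_P4_is_P4 (G : sgraph) (W : {set G}) :
  induces_P4 W -> exists a b c d : G, is_P4 a b c d.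
Proof.
move=> [h [g gK hK] adjh].
have adj_g i j : adj (val (g i)) (val (g j)) = path_adj i j.
  by have := adjh (g i) (g j); rewrite !hK.
have g_neq i j : (val (g i) == val (g j)) = (i == j).
  by rewrite (inj_eq val_inj) (can_eq hK).
exists (val (g ord0)), (val (g (inord 1))), (val (g (inord 2))), (val (g (inord 3))).
by rewrite /is_P4 /= !inE !adj_g !g_neq /path_adj -!val_eqE /= !inordK.
Qed.

(** As [a], [b], [c], [d] already induce a P4, sparseness forbids a P4 through [x] within these five
    vertices. Of the sixteen possible neighbourhoods of [x] on the path, only three survive. *)
Lemma P4_sparse_neighbors (G : sgraph) (a b c d x : G) :
  P4_sparse G -> is_P4 a b c d -> x \notin [:: a; b; c; d] ->
  [/\ adj x a = adj x d, adj x b = adj x c & adj x a -> adj x b].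
Proof.
move=> sparse P4abcd xNabcd.
have unique p q r t :
    {subset [:: p; q; r; t] <= [:: x; a; b; c; d]} -> x \in [:: p; q; r; t] ->
    ~~ is_P4 p q r t.
  move=> sub xin; apply/negP=> P4'; move: (xNabcd).
  suff /setP/(_ x) : [set y in [:: p; q; r; t]] = [set y in [:: a; b; c; d]].
    by rewrite !in_set xin => <-.
  apply: (sparse [set y in [:: x; a; b; c; d]]); try exact: is_P4_induces.
  - rewrite cardsE; apply/card_uniqP.
    by rewrite cons_uniq xNabcd; case/andP: P4abcd.
  - by apply/subsetP=> y; rewrite !in_set; apply: sub.
  - by apply/subsetP=> y; rewrite !in_set => y_in; rewrite inE y_in orbT.
move: (xNabcd) P4abcd; rewrite !inE !negb_or => /and4P[xa xb xc xd].
rewrite /is_P4 /= !inE !negb_or -!andbA => /and5P[nab nac nad nbc].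
move=> /and5P[nbd ncd _ ab /and5P[bc cd ac ad bd]].
have sub p q r t : all (mem [:: x; a; b; c; d]) [:: p; q; r; t] ->
    x \in [:: p; q; r; t] -> ~~ is_P4 p q r t.
  by move=> /allP; apply: unique.
(* Each forbidden neighborhood of x makes one of these eight a second P4. *)
have := (sub x a b c, sub x b c d, sub x c b a, sub x d c b).
have := (sub a x c d, sub d x b a, sub a x d c, sub d x a b).
rewrite /= !inE !eqxx !orbT /= /is_P4 /= !inE.
rewrite !(eq_sym _ x) !(eq_sym b a) !(eq_sym c a) !(eq_sym d a).
rewrite !(eq_sym c b) !(eq_sym d b) !(eq_sym d c).
rewrite !(adj_sym _ x) !(adj_sym b a) !(adj_sym c a) !(adj_sym d a).
rewrite !(adj_sym c b) !(adj_sym d b) !(adj_sym d c).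
rewrite (negPf xa) (negPf xb) (negPf xc) (negPf xd) (negPf nab) (negPf nac).
rewrite (negPf nad) (negPf nbc) (negPf nbd) (negPf ncd) ab bc cd.
rewrite (negPf ac) (negPf ad) (negPf bd).
case: (adj x a); case: (adj x b); case: (adj x c); case: (adj x d) => //=;
by move=> [[[/(_ isT isT) ? /(_ isT isT) ?] /(_ isT isT) ?] /(_ isT isT) ?];
   move=> [[[/(_ isT isT) ? /(_ isT isT) ?] /(_ isT isT) ?] /(_ isT isT) ?].
Qed.

Lemma polar_extend_P4 (s : nat) (G : sgraph) (a b c d : G) :
  P4_sparse G -> is_P4 a b c d -> polar s 1 (induced [set~ b]) -> polar s 1 G.
Proof.
move=> sparse P4abcd /polar_induced_coloring[A [f [subA ltf adjf adjB]]].
have := P4abcd; rewrite /is_P4 /= !inE !negb_or -!andbA.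
move=> /and5P[nab nac nad nbc /and5P[nbd ncd _ ab /and5P[bc cd ac ad bd]]].
have nbr x : x \notin [:: a; b; c; d] ->
  [/\ adj x a = adj x d, adj x b = adj x c & adj x a -> adj x b].
  exact: P4_sparse_neighbors.
have nAb : b \notin A by apply: contraTN isT => /(subsetP subA); rewrite !inE eqxx.
have inB x : x != b -> x \notin A -> x \in [set~ b] :\: A.
  by move=> xb nAx; rewrite !inE nAx xb.
have [e Ae ead] : exists2 e, e \in A & e \in [:: a; d].
  have [Aa | nAa] := boolP (a \in A); first by exists a; rewrite ?inE ?eqxx.
  have [Ad | nAd] := boolP (d \in A); first by exists d; rewrite ?inE ?eqxx ?orbT.
  by move: ad; rewrite adjB ?nad ?inB // eq_sym.
(* The ends of the path go to the multipartite side; [c] leaves it and joins [b] in the clique. *)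
pose A' := [set a; d] :|: (A :\ c).
(* A vertex off the path does not distinguish [a] from [d], so it sees both as it sees [e], whose
   colour is known. *)
have adj_e x : x \in A -> x \notin [:: a; b; c; d] ->
    (adj a x = (f e != f x)) /\ (adj d x = (f e != f x)).
  move=> Ax /nbr[xad _ _]; rewrite -adjf // ![adj _ x]adj_sym.
  by move: ead; rewrite !inE => /orP[]/eqP->; rewrite xad.
apply/polar_coloring.
(* Both [a] and [d] receive the colour of [e], in accordance with their being nonadjacent. *)
exists A', (fun x => f (if x \in [:: a; d] then e else x)); split=> [x | x y | x y].
- rewrite !inE; case: ifP => [_ _ | _ /= /andP[_]]; first exact: ltf.
  exact: ltf.
- have inA' z : z \in A' -> z \notin [:: a; d] ->
      z \in A /\ z \notin [:: a; b; c; d].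
    rewrite !inE => /orP[-> // | /andP[/negPf zc Az]] /norP[/negPf-> /negPf->].
    split=> //; rewrite zc !orbF /=.
    by apply: contraNneq nAb => <-.
  move=> A'x A'y; have [xad | nx] := boolP (x \in _);
    have [yad | ny] := boolP (y \in _).
  + rewrite eqxx; move: xad yad; rewrite !inE.
    by move=> /orP[]/eqP-> /orP[]/eqP->; rewrite ?adj_irr ?[adj d a]adj_sym ?(negPf ad).
  + have [Ay ny'] := inA' y A'y ny; have [ay dy] := adj_e y Ay ny'.
    by move: xad; rewrite !inE => /orP[]/eqP->.
  + have [Ax nx'] := inA' x A'x nx; have [ax dx] := adj_e x Ax nx'.
    by rewrite adj_sym eq_sym; move: yad; rewrite !inE => /orP[]/eqP->.
  + have [Ax _] := inA' x A'x nx; have [Ay _] := inA' y A'y ny.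
    exact: adjf.
(* If all three were in [A], the non-edges [ac] and [ad] would give them one colour, against the
   edge [cd]. *)
have [w /inB wB wacd] : exists2 w, w \notin A & w \in [:: a; c; d].
  have [Aa | nAa] := boolP (a \in A); last by exists a; rewrite ?inE ?eqxx.
  have [Ac | nAc] := boolP (c \in A); last by exists c; rewrite ?inE ?eqxx ?orbT.
  have [Ad | nAd] := boolP (d \in A); last by exists d; rewrite ?inE ?eqxx ?orbT.
  move: ac ad cd; rewrite !adjf // !negbK => /eqP<- /eqP<-.
  by rewrite eqxx.
(* Such a [z] lies off the path and in the old clique, hence is adjacent to [w]. A neighbour of [a],
   [c] or [d] off the path is adjacent to both [b] and [c]. *)
have adj_bc z : z \in ~: A' -> z \notin [:: b; c] -> adj z b /\ adj z c.
  rewrite !inE !negb_or negb_and negbK => /andP[/andP[za zd]].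
  move=> nAz /andP[zb zc]; rewrite (negPf zc) /= in nAz.
  have nz : z \notin [:: a; b; c; d] by rewrite !inE !negb_or za zb zc zd.
  have [zad zbc zab] := nbr z nz; suff zB : adj z b by rewrite -zbc.
  have wb : w != b.
    by apply: contraTneq wacd => ->; rewrite !inE !negb_or (eq_sym b) nab nbc.
  have zw : z != w.
    by apply: contraNneq nz => ->; move: wacd; rewrite !inE => /or3P[]->; rewrite ?orbT.
  move: (adjB z w (inB z zb nAz) (wB wb)); rewrite zw.
  move: wacd; rewrite !inE => /or3P[]/eqP-> //.
  + by rewrite -zbc.
  + by rewrite -zad.
move=> Bx By; have [-> | nxy] := eqVneq x y; first exact: adj_irr.
(* Two vertices outside [b], [c] come from the old clique, mixed pairs follow from [adj_bc], and the
   remaining pair is the edge [bc]. *)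
have [xbc | nx] := boolP (x \in [:: b; c]); last first.
  have [yb | nyb] := eqVneq y b; first by rewrite yb; case: (adj_bc x Bx nx).
  have [yc | nyc] := eqVneq y c; first by rewrite yc; case: (adj_bc x Bx nx).
  move: Bx By nx; rewrite !inE !negb_or !negb_and !negbK.
  move=> /andP[_ nAx] /andP[_ nAy] /andP[xb xc].
  rewrite (negPf xc) (negPf nyc) /= in nAx nAy.
  by rewrite adjB ?inB.
have [ybc | ny] := boolP (y \in [:: b; c]).
  move: xbc ybc nxy; rewrite !inE => /orP[]/eqP-> /orP[]/eqP->; rewrite ?eqxx //.
  by rewrite adj_sym bc.
have [yb yc] := adj_bc y By ny.
by move: xbc; rewrite !inE adj_sym => /orP[]/eqP->.
Qed.

Theorem theorem45 (s : nat) (G : sgraph) :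
  P4_sparse G -> minimal_polar_obstruction s 1 G -> cograph G.
Proof.
move=> sparse [npolar minimal] W /induces_P4_is_P4[a [b [c [d P4abcd]]]].
(* Minimality is applied to [G] minus the inner vertex [b]. *)
apply: npolar; apply: (polar_extend_P4 _ _ a b c d sparse P4abcd); apply: minimal.
by rewrite properT; apply/eqP=> /setP/(_ b); rewrite !inE eqxx.
Qed.
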